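(* Let $m$ and $k$ be positive integers, let $G$ be a group (not necessarily abelian), and let $\mathcal{A}=\{a_sG_s\}_{s=1}^k$ be an $m$-cover of $G$ by left cosets of subgroups $G_1,\ldots,G_k$ of $G$. If $a\in G$ and $w_{\mathcal{A}}(a)=m$, then for any abelian subgroup $K$ of $G$ we have $$k-m\ \ge\ |\{1\le s\le k:\ a\notin a_sG_s\ \text{and}\ K\not\subseteq G_s\}|\ \ge\ f\Big(\Big[K:K\cap\bigcap_{\substack{1\le s\le k\\ a\in a_sG_s}}G_s\Big]\Big),$$ where the index on the right is finite. In particular, if $t\in\{1,\ldots,k\}$ and $\{a_sG_s\}_{1\le s\le k,\ s\neq t}$ fails to be an $m$-cover of $G$, then for any abelian subgroup $K$ of $G$ not contained in $G_t$ we have $$|\{1\le s\le k:\ K\not\subseteq G_s\}|\ \ge\ 1+f([K:G_t\cap K]),$$ where $[K:G_t\cap K]$ is finite.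
   Context: For a finite system (repetitions allowed) $\mathcal{A}=\{a_sG_s\}_{s=1}^k$ of left cosets of subgroups $G_1,\ldots,G_k$ of a group $G$, the covering function is $w_{\mathcal{A}}(x)=|\{1\le s\le k:\ x\in a_sG_s\}|$ for $x\in G$. For a positive integer $m$, $\mathcal{A}$ is an $m$-cover of $G$ if $w_{\mathcal{A}}(x)\ge m$ for all $x\in G$. The Mycielski function $f:\{1,2,3,\ldots\}\to\{0,1,2,\ldots\}$ is given by $f(n)=\sum_{p\in P(n)}\operatorname{ord}_p(n)(p-1)$, where $P(n)$ is the set of prime divisors of $n$ and $\operatorname{ord}_p(n)$ is the largest nonnegative integer $\alpha$ with $p^\alpha\mid n$ (so $f(1)=0$). *)

(* Defs.v *)
From mathcomp Require Import all_boot finmap all_classical.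

Set Implicit Arguments.
Unset Strict Implicit.
Unset Printing Implicit Defensive.

Local Open Scope classical_set_scope.
Local Open Scope group_scope.

Definition is_subgroup (G : groupType) (H : set G) : Prop :=
  group_closed (mem H).

Definition is_abelian (G : groupType) (K : set G) : Prop :=
  {in K &, forall x y : G, commute x y}.

Definition left_coset (G : groupType) (a : G) (H : set G) : set G :=
  [set a * h | h in H].

Definition left_cosets (G : groupType) (K H : set G) : set (set G) :=
  [set left_coset x H | x in K].

Definition finite_index (G : groupType) (K H : set G) : Prop :=
  finite_set (left_cosets K H).

(* [fset_set] sends infinite sets to the empty set, so this is the index
   [K : H] only under [finite_index K H]; otherwise it is a junk 0. *)
Definition group_index (G : groupType) (K H : set G) : nat :=
  #|` fset_set (left_cosets K H)|%fset.

(* A finite system with repetitions is a family indexed by a finType. *)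
Definition covering (I : finType) (T : Type) (A : I -> set T) (x : T) : nat :=
  #|[pred s | x \in A s]|.

Definition is_mcover (m : nat) (I : finType) (T : Type) (A : I -> set T) : Prop :=
  forall x : T, (m <= covering A x)%N.

(* Only meaningful for n > 0; the value at 0 is a junk 0. *)
Definition mycielski (n : nat) : nat :=
  (\sum_(p <- primes n) logn p n * p.-1)%N.

(* Main.v *)
Require Import Defs.
From mathcomp Require Import all_boot all_algebra all_fingroup.
From mathcomp Require Import all_solvable all_field all_character.
From mathcomp Require Import finmap all_classical.
Set Implicit Arguments.
Unset Strict Implicit.
Unset Printing Implicit Defensive.
Import GRing.Theory Num.Theory.

(** Translating by [a] and intersecting with [K] turns the statement into one
    about the abelian group [K].  A point [a * x] with [x] in [K] has at least
    [m] cosets through it, while exactly [m] pass through [a]; so either the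
    cosets through [a] all contain [a * x], which forces [x] into every
    corresponding [H s], or some coset avoiding [a] contains [a * x].  Hence,
    for any subgroup [L] containing the intersection of [K] with those [H s],
    the set [K \ L] is covered by the cosets [a^-1 * g s * H s] that miss [1],
    and only the [s] with [K] not inside [H s] can contribute
    ([mycielski_index_mcover]).  What has to be shown is
    [abelian_cover_index]: if [n] cosets missing [1] cover [K \ L], then
    [K : L] is finite and its Mycielski number is at most [n].

    The coset [L] together with the given ones covers [K], so by B. H. Neumann's
    theorem those of finite index already do; as only [L] contains [1], it is
    one of them.  Now [K] acts by translation on the finite set of all cosets
    of the remaining subgroups, and the image of this action is a finite abelian
    permutation group [A] in which [L] and the [H i] become point stabilizers
    ([coset_permutations]).

    In the finite abelian group [A], with subgroup [B] of index [N], each coset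
    [c i * H i] missing [1] lies in a set [chi_i = z_i], where [chi_i] is a
    linear character that is trivial on [H i] and [z_i = chi_i (c i)] differs
    from [1].  The function [phi = \prod_i (chi_i - z_i)] then vanishes off [B].
    Its Fourier coefficients are algebraic integers, and those of its
    restriction to [B] are [N] times Fourier coefficients of [phi]; so [N]
    divides [phi 1 = \prod_i (1 - z_i)] in the ring of algebraic integers
    ([dvdA_index_cfun1]).  On the other hand each [1 - z_i] is small: for some
    prime [q_i], its power of exponent [q_i - 1] divides [q_i].  Comparing
    [p]-adic valuations, at least [logn p N * (p - 1)] indices [i] have
    [q_i = p]; summing over [p] gives the bound ([mycielski_le_card]).

    The second assertion uses a point [a] that is covered fewer than [m] times
    once the coset number [t] is removed: it is covered exactly [m] times by the
    whole system and lies in that coset, so the above applies with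
    [L = H t `&` K], and [t] itself accounts for the extra [1]. *)

(** * Divisibility in the ring of algebraic integers *)

Section Algebraic.
Local Open Scope ring_scope.

Lemma dvdAP (e x : algC) :
  reflect (exists2 b, b \in Aint & x = e * b) (e %| x)%A.
Proof.
rewrite unfold_in; case: eqP => [-> | /eqP nz_e].
  apply: (iffP eqP) => [->|[b _ ->]]; last by rewrite mul0r.
  by exists 0; rewrite ?rpred0 ?mulr0.
apply: (iffP idP) => [Ab|[b Ab ->]]; last by rewrite mulrC mulKf.
by exists (x / e); rewrite // mulrC divfK.
Qed.

Lemma dvdA_trans (x y z : algC) : (x %| y)%A -> (y %| z)%A -> (x %| z)%A.
Proof.
move=> /dvdAP[b Ab ->] /dvdAP[c Ac ->]; apply/dvdAP.
by exists (b * c); [exact: rpredM | rewrite -mulrA].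
Qed.

Lemma dvdA_mul (x x' y y' : algC) :
  (x %| y)%A -> (x' %| y')%A -> (x * x' %| y * y')%A.
Proof.
move=> /dvdAP[b Ab ->] /dvdAP[c Ac ->]; apply/dvdAP.
by exists (b * c); [exact: rpredM | rewrite mulrACA].
Qed.

Lemma dvdA_refl (x : algC) : (x %| x)%A.
Proof. by apply/dvdAP; exists 1; rewrite ?mulr1 ?rpred1. Qed.

Lemma dvdA_prod (I : Type) (r : seq I) (P : pred I) (E F : I -> algC) :
  (forall i, P i -> (E i %| F i)%A) ->
  (\prod_(i <- r | P i) E i %| \prod_(i <- r | P i) F i)%A.
Proof.
move=> dvEF; apply: (big_ind2 (fun x y : algC => (x %| y)%A)) => //.
- exact: dvdA_refl.
- by move=> *; apply: dvdA_mul.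
Qed.

Lemma dvdA_exp n (x y : algC) : (x %| y)%A -> (x ^+ n %| y ^+ n)%A.
Proof.
move=> /dvdAP[b Ab ->]; apply/dvdAP.
by exists (b ^+ n); [exact: rpredX | rewrite exprMn].
Qed.

(** Evaluate at [1] the factorization of [1 + 'X + ... + 'X^(q - 1)] into linear
    factors over the powers of [w] other than [1]. *)
Lemma prod_sub1_prim_root q (w : algC) :
  (0 < q)%N -> q.-primitive_root w -> \prod_(1 <= i < q) (1 - w ^+ i) = q%:R.
Proof.
case: q => // q _ prim_w.
have /eqP := factor_Xn_sub_1 prim_w.
rewrite big_ltn // expr0 polyC1 subrX1 (inj_eq (mulfI _)) ?polyXsubC_eq0 //.
move/eqP/(congr1 (horner^~ 1)).
rewrite horner_prod horner_sum; under eq_bigr do rewrite hornerXsubC.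
move=> ->; under eq_bigr do rewrite hornerXn expr1n.
by rewrite sumr_const card_ord.
Qed.

(** Take [q] a prime factor of the order of [z]; a power [w] of [z] is then a
    primitive [q]-th root of unity, [1 - z] divides each [1 - w ^+ i] as a
    geometric sum shows, and the product of these for [0 < i < q] is [q]. *)
Lemma dvdA_sub1_unity_root n (z : algC) : (0 < n)%N -> z ^+ n = 1 -> z != 1 ->
  exists2 q, prime q & ((1 - z) ^+ q.-1 %| q%:R)%A.
Proof.
move=> n_gt0 zn1 z_neq1; have [d prim_z _] := prim_order_exists n_gt0 zn1.
have d_gt0 := prim_order_gt0 prim_z.
have d_gt1 : (1 < d)%N.
  rewrite ltn_neqAle d_gt0 andbT eq_sym; apply: contraNneq z_neq1 => d1.
  by rewrite -(prim_expr_order prim_z) d1 expr1.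
have q_pr := pdiv_prime d_gt1; set q := pdiv d in q_pr.
exists q => //.
have prim_w : q.-primitive_root (z ^+ (d %/ q)).
  by rewrite dvdn_prim_root ?pdiv_dvd.
rewrite -(prod_sub1_prim_root (prime_gt0 q_pr) prim_w).
rewrite -subn1 -prodr_const_nat; apply: dvdA_prod => i _.
rewrite -exprM; apply/dvdAP; exists (\sum_(j < d %/ q * i) z ^+ j).
  by apply: rpred_sum => j _; rewrite rpredX // (Aint_prim_root prim_z).
by rewrite -opprB subrX1 -mulNr opprB.
Qed.

End Algebraic.

(** * The Mycielski function and products of numbers [1 - z] *)

Section Mycielski.
Local Open Scope ring_scope.

Lemma dvdA_nat (m n : nat) : (m%:R %| (n%:R : algC))%A = (m %| n)%N.
Proof. by rewrite -eqAmod0 (eqAmod0_nat m n). Qed.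

(** Attach to each [z i] a prime [q i] such that [1 - z i] to the power
    [(q i).-1] divides [q i].  For a prime [p], raising the hypothesis to the
    power [p.-1] shows that [N ^ p.-1] divides a product in which each [i] with
    [q i = p] contributes one factor [p] and the other [i] contribute numbers
    prime to [p].  Each [i] is thus counted for a single prime. *)
Lemma mycielski_le_card (I : finType) (N n : nat) (z : I -> algC) :
    (0 < n)%N -> (forall i, z i ^+ n = 1) -> (forall i, z i != 1) ->
  (N%:R %| \prod_i (1 - z i))%A -> (mycielski N <= #|I|)%N.
Proof.
move=> n_gt0 zn1 z_neq1 dvN.
have /fin_all_exists2[q q_pr dvq] i :
    exists2 q, prime q & ((1 - z i) ^+ q.-1 %| q%:R)%A.
  exact: dvdA_sub1_unity_root n_gt0 (zn1 i) (z_neq1 i).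
have logN p : prime p -> (logn p N * p.-1 <= #|[pred i | q i == p]|)%N.
  move=> p_pr.
  pose b i := (if q i == p then p else q i ^ p.-1)%N.
  have b_gt0 i : (0 < b i)%N.
    by rewrite /b; case: ifP; rewrite ?expn_gt0 prime_gt0.
  have: (N ^ p.-1 %| \prod_i b i)%N.
    rewrite -dvdA_nat natrX natr_prod.
    apply: dvdA_trans (dvdA_exp _ dvN) _.
    rewrite -prodrXl; apply: dvdA_prod => i _; rewrite /b.
    case: eqP => [<-|_]; first exact: dvq.
    rewrite natrX; apply: dvdA_exp; apply: dvdA_trans (dvq i).
    have := prime_gt1 (q_pr i); case: (q i) => [|[|r]] // _ /=.
    apply/dvdAP; exists ((1 - z i) ^+ r); last by rewrite exprS.
    rewrite rpredX // rpredB ?rpred1 //; apply: (@Aint_unity_root n) => //.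
    by apply/unity_rootP.
  move/(dvdn_leq_log p); rewrite prodn_gt0 // => /(_ isT).
  rewrite lognX mulnC => /leq_trans; apply.
  have logb i : (logn p (b i) <= (q i == p))%N.
    rewrite /b; case: eqP => [<-|/eqP neq_qp]; first by rewrite logn_prime ?eqxx.
    by rewrite lognX logn_prime // eq_sym (negPf neq_qp) muln0.
  rewrite -sum1_card [leqRHS]big_mkcond /=.
  have: (0 < \prod_i b i)%N &&
        (logn p (\prod_i b i) <= \sum_i (q i == p : nat))%N.
    elim/big_rec2: _ => [|i s t _ /andP[t_gt0 le_ts]]; first by rewrite logn1.
    by rewrite muln_gt0 b_gt0 t_gt0 lognM // leq_add.
  by case/andP => _ /leq_trans; apply; apply: leq_sum => i _; rewrite inE; case: ifP.
rewrite /mycielski; apply: (@leq_trans (\sum_(p <- primes N) #|[pred i | q i == p]|)).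
  by rewrite !big_seq; apply: leq_sum => p; rewrite mem_primes => /andP[/logN].
under eq_bigr do rewrite -sum1_card big_mkcond.
rewrite exchange_big -sum1_card; apply: leq_sum => i _ /=.
under eq_bigr do rewrite inE.
rewrite -big_mkcond sum1_count (eq_count (a2 := pred1 (q i))).
  by rewrite count_uniq_mem ?primes_uniq // leq_b1.
by move=> p; rewrite /= eq_sym.
Qed.

End Mycielski.

(** * Covers of a finite abelian group *)

Section FiniteGroup.
Local Open Scope ring_scope.

Section AintCoef.
Variables (gT : finGroupType) (A : {group gT}).

Definition Aint_coef (phi : 'CF(A)) := forall i, '[phi, 'chi_i] \in Aint.

Lemma Aint_coef1 : Aint_coef 1.
Proof. by move=> i; rewrite -irr0 cfdot_irr; apply: Aint_Cnat; rewrite natr_nat. Qed.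

(** Multiplication by a linear character permutes the Fourier coefficients. *)
Lemma Aint_coef_mul_lin_sub (xi phi : 'CF(A)) a :
    xi \is a linear_char -> a \in Aint -> Aint_coef phi ->
  Aint_coef ((xi - a%:A) * phi).
Proof.
move=> lin_xi Aa Aphi i.
rewrite mulrBl cfdotBl -scalerAl mul1r cfdotZl.
apply: rpredB; last by apply: rpredM; [exact: Aa | exact: Aphi].
have lin_xiC : (xi^*)%CF \is a linear_char by rewrite cfConjC_lin_char.
have /irrP[j def_j] := mul_lin_irr lin_xiC (mem_irr i).
suffices -> : '[xi * phi, 'chi_i] = '[phi, 'chi_j] by [].
rewrite -def_j !cfdotE; congr (_ * _); apply: eq_bigr => x _.
by rewrite !cfunE rmorphM /= conjCK mulrCA mulrA.
Qed.

End AintCoef.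

(** A character of [B] extends to a character ['chi_j] of [A].  As [phi] lives
    on [B], the scalar products of [phi] with ['chi_j] over [A] and over [B]
    involve the same sum and differ only by the normalizing factor, the index
    of [B]; and [phi 1] is the sum of the scalar products over [B]. *)
Lemma dvdA_index_cfun1 (gT : finGroupType) (A B : {group gT}) (phi : 'CF(A)) :
    abelian A -> B \subset A -> Aint_coef phi -> phi \in 'CF(A, B) ->
  (#|A : B|%g%:R %| phi 1%g)%A.
Proof.
move=> abA sBA Aphi phi_B.
have abB := abelianS sBA abA.
have lin1 (D : {group gT}) i : abelian D -> 'chi[D]_i 1%g = 1.
  by move=> abD; apply: lin_char1; apply/char_abelianP.
rewrite -(cfResE phi sBA (group1 B)) ['Res phi]cfun_sum_cfdot sum_cfunE.
apply: rpred_sum => i _; rewrite cfunE lin1 // mulr1.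
have [j] := constt_cfInd_irr i sBA.
rewrite constt_Ind_Res => i_j.
have /lin_char_irr/irrP[l def_l]: 'Res[B] 'chi_j \is a linear_char.
  by apply/cfRes_lin_char/char_abelianP.
have def_i: 'chi_i = 'Res[B] 'chi_j.
  by move: i_j; rewrite def_l constt_irr => /eqP->.
apply/dvdAP; exists '[phi, 'chi_j]; first exact: Aphi.
rewrite (cfdotEl _ phi_B) cfdotE natf_indexg //.
rewrite [RHS]mulrA; congr (_ * _); first by rewrite mulrAC divff ?neq0CG ?mul1r.
by apply: eq_bigr => x Bx; rewrite def_i !cfResE.
Qed.

(** A normal subgroup is the intersection of the kernels of the irreducible
    characters that are trivial on it. *)
Lemma cfker_separates (gT : finGroupType) (A H : {group gT}) (c : gT) :
    abelian A -> H \subset A -> c \in A -> c \notin H ->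
  exists2 i, H \subset cfker 'chi[A]_i & 'chi[A]_i c != 1.
Proof.
move=> abA sHA Ac; have nsHA : (H <| A)%g by rewrite -sub_abelian_normal.
rewrite -{1}(cap_cfker_normal nsHA) => /bigcapP ker_c.
have /existsP[i /andP[sHi ci]] :
    [exists i, (H \subset cfker 'chi[A]_i) && (c \notin cfker 'chi_i)].
  apply: contraT; rewrite negb_exists => /forallP no_i; case: ker_c => i sHi.
  by have := no_i i; rewrite sHi negbK.
exists i => //; apply: contra ci => ci1.
by rewrite cfkerEirr inE (eqP ci1) eq_sym lin_char1 //; apply/char_abelianP.
Qed.

(** The function [\prod_i ('chi_(j i) - z i)], where ['chi_(j i)] is trivial on
    [H i] and takes the value [z i != 1] at [c i], vanishes wherever a coset
    [c i *: H i] passes, hence outside [B]. *)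
Theorem mycielski_indexg (gT : finGroupType) (A B : {group gT})
    (I : finType) (c : I -> gT) (H : I -> {group gT}) :
    abelian A -> B \subset A ->
    (forall i, H i \subset A) -> (forall i, c i \in A) ->
    (forall i, c i \notin H i) ->
    {in A :\: B, forall x, exists i, x \in (c i *: H i)%g} ->
  (mycielski #|A : B|%g <= #|I|)%N.
Proof.
move=> abA sBA sHA Ac Hc cov.
have /fin_all_exists2[j kerj j_c] i := cfker_separates abA (sHA i) (Ac i) (Hc i).
have lin i : 'chi_(j i) \is a linear_char by apply/char_abelianP.
pose z i := 'chi_(j i) (c i).
have zn1 i : z i ^+ #|A| = 1.
  by rewrite -lin_charX ?Ac // expg_cardG ?lin_char1.
apply: (mycielski_le_card (cardG_gt0 A) zn1 j_c).
pose phi : 'CF(A) := \prod_i ('chi_(j i) - (z i)%:A).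
have phiE x : x \in A -> phi x = \prod_i ('chi_(j i) x - z i).
  move=> Ax; rewrite /phi prod_cfunE //; apply: eq_bigr => i _.
  by rewrite !cfunE cfun1E Ax mulr1.
have -> : \prod_i (1 - z i) = phi 1%g.
  by rewrite phiE //; apply: eq_bigr => i _; rewrite lin_char1.
apply: dvdA_index_cfun1 => //.
  rewrite /phi; apply: big_rec => [|i psi _ IH]; first exact: Aint_coef1.
  apply: Aint_coef_mul_lin_sub => //.
  by apply: (@Aint_unity_root #|A|) => //; apply/unity_rootP.
apply/cfun_onP => x Bx; have [Ax|/cfun0->//] := boolP (x \in A).
have [|i] := cov x; first by rewrite inE Bx.
case/lcosetP => h Hh def_x; rewrite phiE // (bigD1 i) //= def_x.
rewrite lin_charM ?Ac ?(fintype.subsetP (sHA i) h) //.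
by rewrite (cfker1 (fintype.subsetP (kerj i) h Hh)) lin_char1 // mulr1 subrr mul0r.
Qed.

End FiniteGroup.

(** * Subgroups and cosets in an arbitrary group *)

Section Cosets.
Local Open Scope classical_set_scope.
Local Open Scope group_scope.
Variable G : groupType.
Implicit Types (H K L : set G) (x y : G).

Lemma subgroup1 H : is_subgroup H -> H 1.
Proof. by case=> /set_mem. Qed.

Lemma subgroupM H x y : is_subgroup H -> H x -> H y -> H (x * y).
Proof.
move=> /group_closedM clH Hx Hy; apply: set_mem.
by apply: clH; apply: mem_set.
Qed.

Lemma subgroupV H x : is_subgroup H -> H x -> H x^-1.
Proof.
by move=> /group_closedV clH Hx; apply: set_mem; apply: clH; apply: mem_set.
Qed.

Lemma subgroupI H K :
  is_subgroup H -> is_subgroup K -> is_subgroup (H `&` K).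
Proof.
move=> sgH sgK; split=> [|x y /set_mem[Hx Kx] /set_mem[Hy Ky]]; apply: mem_set.
  by split; apply: subgroup1.
by split; apply: subgroupM => //; apply: subgroupV.
Qed.

Lemma left_cosetE x H y : left_coset x H y = H (x^-1 * y).
Proof.
apply/propext; split=> [[h Hh <-]|Hxy]; first by rewrite mulKg.
by exists (x^-1 * y); rewrite ?mulVKg.
Qed.

Lemma left_coset1 H : left_coset 1 H = H.
Proof. by apply/funext => x; rewrite left_cosetE invg1 mul1g. Qed.

Lemma left_cosetM x y H : left_coset x (left_coset y H) = left_coset (x * y) H.
Proof.
by apply/funext => z; rewrite !left_cosetE invgM mulgA.
Qed.

Lemma left_coset_inj x : injective (left_coset x).
Proof.
by move=> C D /(congr1 (left_coset x^-1)); rewrite !left_cosetM mulVg !left_coset1.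
Qed.

Lemma eq_left_coset H x y :
  is_subgroup H -> left_coset x H = left_coset y H <-> H (x^-1 * y).
Proof.
move=> sgH; split=> [eq_xy|Hxy].
  by rewrite -left_cosetE eq_xy left_cosetE mulVg; apply: subgroup1.
apply/seteqP; split=> z; rewrite !left_cosetE => Hz.
  have -> : y^-1 * z = (x^-1 * y)^-1 * (x^-1 * z) by rewrite invgM invgK -!mulgA mulVKg.
  exact: subgroupM (subgroupV _ _) _.
have -> : x^-1 * z = (x^-1 * y) * (y^-1 * z) by rewrite -!mulgA mulVKg.
exact: subgroupM.
Qed.

(** [T] is the set of all left cosets of all the [H i], [f] its embedding into
    the sets, [pt i] the point [H i] itself, and [rho x] the left translation
    by [x].  Products of permutations are read from left to right, so that
    [rho] reverses products. *)
Lemma coset_permutations K (I : finType) (H : I -> set G) :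
    is_subgroup K -> (forall i, finite_index K (H i)) ->
  exists (T : finType) (f : T -> set G) (rho : G -> {perm T}) (pt : I -> T),
    [/\ injective f,
        {in K &, forall x y, rho (x * y) = rho y * rho x}
      & forall i x, K x -> f (rho x (pt i)) = left_coset x (H i)].
Proof.
move=> sgK fiH.
pose X : set (set G) := \bigcup_i left_cosets K (H i).
have finX : finite_set X.
  by apply: bigcup_finite => // i _; apply: fiH.
have Xmul x C : K x -> X C -> X (left_coset x C).
  move=> Kx [i _ [y Ky <-]]; exists i => //; exists (x * y).
    exact: subgroupM.
  by rewrite left_cosetM.
pose T : finType := fset_set X; pose f : T -> set G := val.
have fX t : X (f t) by have := valP t; rewrite in_fset_set // inE.
(* Replacing [x] by [1] outside [K] makes [rho] total. *)
pose k x := if x \in K then x else 1.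
have Kk x : K (k x) by rewrite /k; case: ifP => [/set_mem|_ ]; last exact: subgroup1.
have Tmul x t : left_coset (k x) (f t) \in fset_set X.
  by rewrite in_fset_set // inE; apply: Xmul.
pose tr x t : T := [` Tmul x t]%fset.
have tr_inj x : injective (tr x).
  by move=> t u /(congr1 val) /left_coset_inj /val_inj.
have XH i : H i \in fset_set X.
  rewrite in_fset_set // inE; exists i => //; exists 1; first exact: subgroup1.
  by rewrite left_coset1.
exists T, f, (fun x => perm (tr_inj x)), (fun i => [` XH i]%fset).
have ftr x t : K x -> f (perm (tr_inj x) t) = left_coset x (f t).
  by move=> Kx; rewrite permE -[LHS]/(left_coset (k x) (f t)) /k mem_set.
split=> [|x y Kx Ky|i x Kx]; first exact: val_inj.
  move/set_mem: Kx => Kx; move/set_mem: Ky => Ky.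
  apply/permP => t; apply: val_inj; rewrite permM.
  rewrite -!/(f _) !ftr ?left_cosetM //; exact: subgroupM.
by rewrite ftr.
Qed.

(** * Neumann's theorem on coset covers *)

(** Induction on the list of subgroups, all cosets being cut down to their part
    in [K].  As [H] has infinite index, some coset [y * H] is different from all
    [x * H] with [x] in [X], hence disjoint from them and covered by the cosets
    of the other subgroups.  Translating, each [x * H] is covered by finitely
    many cosets of the other subgroups, so [H] can be dropped from the list, at
    the price of more translates. *)
Lemma no_infinite_index_cover K (s : seq (set G)) (X : seq G) :
    is_subgroup K -> (forall H, H \in s -> is_subgroup H) ->
    (forall H, H \in s -> ~ finite_index K H) -> {in X, forall x, K x} ->
  ~ (forall y, K y ->
       exists H x, [/\ H \in s, x \in X & left_coset x H y]).
Proof.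
move=> sgK; elim: s X => [|H s IHs] X sgs infs KX covK.
  by have [H [x []]] := covK _ (subgroup1 sgK).
have Hs : H \in H :: s by rewrite mem_head.
have [y [Ky Hy]] : exists y, K y /\ forall x, x \in X -> ~ H (x^-1 * y).
  apply: contrapT => no_y; apply: (infs H Hs).
  apply: (@sub_finite_set _ _ [set left_coset x H | x in [set` X]]).
    move=> _ [y Ky <-]; apply: contrapT => nXy; apply: no_y; exists y; split=> // x Xx.
    move=> Hxy; apply: nXy; exists x => //.
    by apply/(eq_left_coset _ _ (sgs _ Hs)).
  exact/finite_image/finite_seq.
have covs z : K z -> H (y^-1 * z) ->
    exists H' x, [/\ H' \in s, x \in X & left_coset x H' z].
  move=> Kz Hyz; have [H' [x []]] := covK z Kz.
  rewrite inE => /orP[/eqP-> Xx|]; last by exists H', x.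
  rewrite left_cosetE => Hxz; case: (Hy x Xx).
  have -> : x^-1 * y = x^-1 * z * (y^-1 * z)^-1 by rewrite invgM invgK !mulgA mulgK.
  exact: subgroupM (sgs _ Hs) Hxz (subgroupV (sgs _ Hs) Hyz).
apply: (IHs (X ++ [seq x * y^-1 * w | x <- X, w <- X])) => [H' sH'|H' sH'|x|z Kz].
- by apply: sgs; rewrite inE sH' orbT.
- by apply: infs; rewrite inE sH' orbT.
- rewrite mem_cat => /orP[/KX //|/allpairsP[[u v] /= [/KX Ku /KX Kv ->]]].
  by do !apply: subgroupM => //; apply: subgroupV.
have [H' [x [sH' Xx]]] := covK z Kz; move: sH'; rewrite inE => /orP[/eqP->|sH' xz].
  rewrite left_cosetE => Hxz.
  have [|| H'' [w [sH'' Xw ]]] := covs (y * x^-1 * z).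
  - by do !apply: subgroupM => //; apply: subgroupV => //; apply: KX.
  - by rewrite -mulgA mulKg.
  rewrite left_cosetE => zw; exists H'', (x * y^-1 * w); split=> //.
    by rewrite mem_cat; apply/orP; right; apply/allpairsP; exists (x, w).
  by rewrite left_cosetE !invgM invgK -!mulgA in zw *.
by exists H', x; split=> //; rewrite mem_cat Xx.
Qed.

(** Let [D] be the intersection of [K] and the [H i] of finite index.  If [x] were missed
    by all their cosets, then so would [x * D], which would have to be covered
    by cosets of infinite index; as [K] is a finite union of translates of [D],
    so would [K].  The translation action on the cosets of the [H i] of finite
    index provides the finite set of representatives modulo [D]. *)
Lemma neumann_finite_index_cover K (I : finType) (c : I -> G) (H : I -> set G) :
    is_subgroup K -> (forall i, is_subgroup (H i)) -> (forall i, K (c i)) ->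
    (forall x, K x -> exists i, left_coset (c i) (H i) x) ->
  forall x, K x ->
    exists i, finite_index K (H i) /\ left_coset (c i) (H i) x.
Proof.
move=> sgK sgH Kc cov x Kx; apply: contrapT => no_i.
pose J := {i : I | `[< finite_index K (H i) >]}.
have fiJ (j : J) : finite_index K (H (val j)) by apply/asboolP; apply: (valP j).
have [T [f [rho [pt [inj_f _ rhoE]]]]] := coset_permutations sgK fiJ.
(* [rep t] is some element of [K] acting as [t], and [1] if there is none. *)
have /choice[rep repP] (t : {perm T}) :
    exists y, K y /\ forall z, K z -> rho z = t -> rho y = t.
  have [[y [Ky rho_y]]|no_y] := pselect (exists y, K y /\ rho y = t).
    by exists y.
  exists 1; split=> [|z Kz rho_z]; first exact: subgroup1.
  by case: no_y; exists z.
pose s := [seq H i | i <- enum I & ~~ `[< finite_index K (H i) >]].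
pose X := [seq rep t * x^-1 * c i | t <- enum {perm T}, i <- enum I].
apply: (@no_infinite_index_cover K s X) => // [H'|H'|z|y Ky].
- by case/mapP => i _ ->.
- by case/mapP => i; rewrite mem_filter => /andP[/asboolPn nfi _] ->.
- case/allpairsP => [[t i] /= [_ _ ->]].
  by do !apply: subgroupM => //; [case: (repP t) | apply: subgroupV].
have [Krep rho_rep] := repP (rho y); set r := rep (rho y) in Krep rho_rep.
have Hry i : finite_index K (H i) -> H i (r^-1 * y).
  move=> fi_i; have fi_i' : `[< finite_index K (H i) >] by apply/asboolP.
  apply/eq_left_coset => //; pose j : J := exist _ i fi_i'.
  by rewrite -[H i]/(H (val j)) -!rhoE // (rho_rep y).
have [i ciy] : exists i, left_coset (c i) (H i) (x * r^-1 * y).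
  by apply: cov; do !apply: subgroupM => //; apply: subgroupV.
exists (H i), (r * x^-1 * c i); split.
- apply/mapP; exists i => //; rewrite mem_filter mem_enum andbT.
  apply/asboolPn => fi_i; apply: no_i; exists i; split=> //.
  move: ciy; rewrite !left_cosetE => ciy.
  have -> : (c i)^-1 * x = (c i)^-1 * (x * r^-1 * y) * (r^-1 * y)^-1.
    by rewrite invgM invgK !mulgA mulgK mulgKV.
  exact: subgroupM (sgH i) ciy (subgroupV (sgH i) (Hry i fi_i)).
- by apply/allpairsP; exists (rho y, i); rewrite !mem_enum.
by move: ciy; rewrite !left_cosetE !invgM invgK -!mulgA.
Qed.

(** * Covers of an abelian subgroup *)

(** The finite group [A] is the group of permutations induced by [K] on the
    cosets of [L] and of the [H i]; here [None] stands for [L], whose orbit is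
    the set of cosets of [L], and the subgroups are the stabilizers [St o]. *)
Lemma mycielski_group_index_finite K L (I : finType) (c : I -> G)
    (H : I -> set G) :
    is_subgroup K -> is_abelian K -> is_subgroup L ->
    (forall i, is_subgroup (H i)) ->
    finite_index K L -> (forall i, finite_index K (H i)) ->
    (forall i, K (c i)) -> (forall i, ~ H i (c i)) ->
    (forall x, K x -> ~ L x -> exists i, left_coset (c i) (H i) x) ->
  (mycielski (group_index K L) <= #|I|)%N.
Proof.
move=> sgK abK sgL sgH fiL fiH Kc Hc cov.
pose H' (o : option I) := if o is Some i then H i else L.
have sgH' o : is_subgroup (H' o) by case: o.
have fiH' o : finite_index K (H' o) by case: o.
have [T [f [rho [pt [inj_f rhoM rhoE]]]]] := coset_permutations sgK fiH'.
have rho1 : rho 1 = 1.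
  by apply: (mulgI (rho 1)); rewrite -rhoM ?mulg1 // mem_set //; apply: subgroup1.
have fix_rho o x : K x -> (rho x (pt o) == pt o) = `[< H' o x >].
  move=> Kx; rewrite -(inj_eq inj_f); have K1 := subgroup1 sgK.
  have <- : f (rho 1 (pt o)) = f (pt o).
    by rewrite rho1 perm1.
  rewrite !rhoE // eq_sym; apply/eqP/asboolP.
    by move/(eq_left_coset _ _ (sgH' o)); rewrite invg1 mul1g.
  by move=> Hx; apply/(eq_left_coset _ _ (sgH' o)); rewrite invg1 mul1g.
pose A := [set s : {perm T} | `[< exists2 x, K x & s = rho x >]]%SET.
have AP s : reflect (exists2 x, K x & s = rho x) (s \in A).
  by rewrite inE; apply: asboolP.
have gA : group_set A.
  apply/group_setP; split=> [|_ _ /AP[x Kx ->] /AP[y Ky ->]]; apply/AP.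
    by exists 1; rewrite ?rho1 //; apply: subgroup1.
  by exists (y * x); rewrite ?rhoM ?mem_set //; apply: subgroupM.
pose gpA := Group gA.
have abA : abelian gpA.
  apply/centsP => _ /AP[x Kx ->] _ /AP[y Ky ->].
  by rewrite /commute -!rhoM ?mem_set //; rewrite abK ?mem_set.
pose St o := ('C_gpA[pt o | 'P])%G.
have StE o x : K x -> (rho x \in St o) = `[< H' o x >].
  move=> Kx; rewrite inE -fix_rho // (sameP astab1P eqP).
  by rewrite andb_idl // => _; apply/AP; exists x.
have <- : #|gpA : St None| = group_index K L.
  rewrite -card_orbit /group_index.
  have -> : fset_set (left_cosets K L) =
            [fset f t | t in orbit 'P gpA (pt None)]%fset.
    apply/fsetP => C; rewrite in_fset_set //; apply/idP/imfsetP => /=.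
      rewrite inE => -[x Kx <-]; exists (rho x (pt None)); last by rewrite rhoE.
      by apply/orbitP; exists (rho x) => //; apply/AP; exists x.
    case=> _ /orbitP[_ /AP[x Kx ->] <-] ->; rewrite inE.
    by exists x; rewrite //= -[L]/(H' None) -rhoE.
  by rewrite card_imfset //= -cardE.
apply: (mycielski_indexg (c := fun i => rho (c i)) (H := fun i => St (Some i))) => //.
- exact: subsetIl.
- by move=> i; apply: subsetIl.
- by move=> i; apply/AP; exists (c i).
- by move=> i; rewrite StE //; apply/asboolPn; apply: Hc.
move=> _ /setDP[/AP[x Kx ->]]; rewrite StE // => /asboolPn /(cov x Kx)[i cix].
exists i; have KcVx : K ((c i)^-1 * x) by apply: subgroupM => //; apply: subgroupV.
rewrite mem_lcoset.
have -> : rho x = rho (c i) * rho ((c i)^-1 * x).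
  rewrite -rhoM ?mem_set //; congr rho.
  by rewrite -mulgA (abK x) ?mem_set // mulKg.
by rewrite mulKg StE //; apply/asboolP; rewrite -left_cosetE.
Qed.

(** Cosets that do not meet [K] are dropped, the other ones are written with
    representatives [d j] in [K], and Neumann's theorem is applied to them
    together with the coset [L], indexed by [None].  No other coset than [L]
    contains [1], so [L] survives in the resulting cover. *)
Theorem abelian_cover_index K L (I : finType) (P : pred I) (c : I -> G)
    (H : I -> set G) :
    is_subgroup K -> is_abelian K -> is_subgroup L ->
    (forall i, is_subgroup (H i)) ->
    (forall i, P i -> ~ left_coset (c i) (H i) 1) ->
    (forall x, K x -> ~ L x -> exists2 i, P i & left_coset (c i) (H i) x) ->
  finite_index K L /\ (mycielski (group_index K L) <= #|P|)%N.
Proof.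
move=> sgK abK sgL sgH nc1 cov.
pose J0 := {i : I | P i && `[< exists2 x, K x & left_coset (c i) (H i) x >]}.
have /choice[d dP] (j : J0) : exists x, K x /\ left_coset (c (val j)) (H (val j)) x.
  by case/andP: (valP j) => _ /asboolP[x]; exists x.
have cd j : left_coset (c (val j)) (H (val j)) = left_coset (d j) (H (val j)).
  by apply/(eq_left_coset _ _ (sgH _)); rewrite -left_cosetE; case: (dP j).
pose H' (o : option J0) := if o is Some j then H (val j) else L.
pose d' o := if o is Some j then d j else 1.
have [fiL fiJ] : finite_index K L /\ (forall x, K x -> ~ L x -> exists j,
    finite_index K (H (val j)) /\ left_coset (d j) (H (val j)) x).
  have neu x : K x ->
      exists o, finite_index K (H' o) /\ left_coset (d' o) (H' o) x.
    apply: (neumann_finite_index_cover (c := d') (H := H')) => // [[j|]|[j|]|y Ky] //=.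
    - by case: (dP j).
    - exact: subgroup1.
    have [Ly|nLy] := pselect (L y); first by exists None; rewrite /= left_coset1.
    have [i Pi ciy] := cov y Ky nLy.
    have J0i : P i && `[< exists2 x, K x & left_coset (c i) (H i) x >].
      by rewrite Pi; apply/asboolP; exists y.
    by exists (Some (exist _ i J0i)); rewrite /= -cd.
  split=> [|x Kx nLx].
    have [[j|] [] //=] := neu 1 (subgroup1 sgK).
    by rewrite -cd => _ cj1; case/andP: (valP j) => /nc1.
  have [[j|] [fij /= xj]] := neu x Kx; first by exists j.
  by case: nLx; rewrite left_coset1 in xj.
split=> //.
pose J := {j : J0 | `[< finite_index K (H (val j)) >]}.
apply: (@leq_trans #|{: J}|).
  apply: (@mycielski_group_index_finite K L J
    (fun j => d (val j)) (fun j => H (val (val j)))) => //.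
  - by move=> j; apply/asboolP; apply: (valP j).
  - by move=> j; case: (dP (val j)).
  - move=> j Hd; case/andP: (valP (val j)) => /nc1 nc _; apply: nc.
    by rewrite cd left_cosetE mulg1; apply: subgroupV.
  move=> x Kx /(fiJ x Kx)[j [fij djx]].
  have fij' : `[< finite_index K (H (val j)) >] by apply/asboolP.
  by exists (exist _ j fij').
rewrite card_sig; apply: (leq_trans (max_card _)).
rewrite card_sig; apply: subset_leq_card; apply/fintype.subsetP => i.
by rewrite !inE => /andP[].
Qed.

End Cosets.

(** * Covers with multiplicity *)

Local Open Scope classical_set_scope.

Section MCover.
Local Open Scope group_scope.
Variables (I : finType) (G : groupType) (g : I -> G) (H : I -> set G).
Hypothesis sgH : forall s, is_subgroup (H s).
Let A s := left_coset (g s) (H s).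
Implicit Types (a x : G) (K L : set G).

Lemma mem_left_coset_mulr s a x :
  A s a -> left_coset (a^-1 * g s) (H s) x -> H s x.
Proof.
rewrite /A !left_cosetE invgM invgK => Ha Hx.
have -> : x = ((g s)^-1 * a)^-1 * ((g s)^-1 * a * x) by rewrite mulKg.
exact: subgroupM (sgH s) (subgroupV (sgH s) Ha) Hx.
Qed.

(** If no coset outside those through [a] contained [a * x], then the set of
    cosets through [a * x] would be part of the set of cosets through [a]; the
    latter has the minimal size [m], so the two would be equal and [x] would be
    in all the corresponding subgroups. *)
Lemma exists_other_coset m a x :
    is_mcover m A -> covering A a = m ->
    ~ (forall s, A s a -> H s x) ->
  exists2 s, ~ A s a & left_coset (a^-1 * g s) (H s) x.
Proof.
move=> covA wa nHx; apply: contrapT => no_s; apply: nHx => s sa.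
have Ax t : A t (a * x) = left_coset (a^-1 * g t) (H t) x.
  by rewrite /A !left_cosetE invgM invgK mulgA.
have sub : [pred t | a * x \in A t] \subset [pred t | a \in A t].
  apply/fintype.subsetP => t; rewrite !inE => axt.
  by apply: contrapT => not_at; apply: no_s; exists t; rewrite -?Ax.
have [_] := subset_leqif_card sub.
rewrite eqn_leq (subset_leq_card sub) -[X in (X <= _)%N]/(covering A a) wa.
rewrite covA => /esym/fintype.subsetP/(_ s); rewrite !inE => /(_ sa) axs.
by apply: (mem_left_coset_mulr sa); rewrite -Ax.
Qed.

(** Any [L] that contains the intersection is allowed because the two parts of
    the final theorem use different choices: the intersection itself, and
    [H t `&` K]. *)
Lemma mycielski_index_mcover m a K L :
    is_mcover m A -> covering A a = m ->
    is_subgroup K -> is_abelian K -> is_subgroup L ->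
    (forall x, K x -> (forall s, A s a -> H s x) -> L x) ->
  finite_index K L /\
  (mycielski (group_index K L)
     <= #|[pred s | (a \notin A s) && ~~ `[< K `<=` H s >]]|)%N.
Proof.
move=> covA wa sgK abK sgL subL.
apply: (abelian_cover_index (c := fun s => a^-1 * g s) (H := H)) => //.
  move=> s /andP[nsa _]; rewrite left_cosetE invgM invgK mulg1 => Ha.
  by move/negP: nsa; apply; rewrite inE /A left_cosetE.
move=> x Kx nLx.
have [|s nsa xs] := exists_other_coset (x := x) covA wa.
  by move=> Hx; apply: nLx; apply: subL.
exists s => //; apply/andP; split; first by apply/negP; rewrite inE.
apply/asboolPn => /(_ x Kx) Hx; apply: nsa; move: xs.
rewrite /A !left_cosetE invgM invgK => xs.
have -> : (g s)^-1 * a = (g s)^-1 * a * x * x^-1 by rewrite mulgK.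
exact: subgroupM (sgH s) xs (subgroupV (sgH s) Hx).
Qed.

End MCover.

Theorem corollary1p1 (m k : nat) (m_gt0 : (0 < m)%N) (k_gt0 : (0 < k)%N)
    (G : groupType) (g : 'I_k -> G) (H : 'I_k -> set G)
    (H_subgroup : forall s : 'I_k, is_subgroup (H s))
    (A_mcover : is_mcover m (fun s : 'I_k => left_coset (g s) (H s))) :
  (forall a : G, covering (fun s : 'I_k => left_coset (g s) (H s)) a = m ->
   forall K : set G, is_subgroup K -> is_abelian K ->
   let L : set G :=
     K `&` \bigcap_(s in [set s : 'I_k | a \in left_coset (g s) (H s)]) H s in
   let c : nat :=
     #|[pred s : 'I_k | (a \notin left_coset (g s) (H s))
                        && ~~ `[< K `<=` H s >]]| in
   [/\ finite_index K L,
       (c <= k - m)%N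
     & (mycielski (group_index K L) <= c)%N])
  /\
  (forall t : 'I_k,
   ~ is_mcover m
       (fun s : {s : 'I_k | s != t} => left_coset (g (val s)) (H (val s))) ->
   forall K : set G, is_subgroup K -> is_abelian K -> ~ K `<=` H t ->
   finite_index K (H t `&` K) /\
   (1 + mycielski (group_index K (H t `&` K))
      <= #|[pred s : 'I_k | ~~ `[< K `<=` H s >]]|)%N).
Proof.
split=> [a wa K sgK abK L c|t not_cov K sgK abK nKH].
  have sgL : is_subgroup L.
    apply: subgroupI => //; split=> [|x y /set_mem Hx /set_mem Hy].
      by apply: mem_set => s _; apply: subgroup1.
    apply: mem_set => s sa; apply: subgroupM => //; first exact: Hx.
    by apply: subgroupV => //; apply: Hy.
  have subL x : K x -> (forall s, left_coset (g s) (H s) a -> H s x) -> L x.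
    by move=> Kx Hx; split=> // s /= /set_mem; apply: Hx.
  have [fiL leL] := mycielski_index_mcover H_subgroup A_mcover wa sgK abK sgL subL.
  split=> //; rewrite -[X in (X - _)%N]card_ord -wa.
  rewrite -(cardC [pred s | a \in left_coset (g s) (H s)]) addKn.
  by apply: subset_leq_card; apply/fintype.subsetP => s; rewrite !inE => /andP[].
have [a lt_a] : exists a, (covering (fun s : {s : 'I_k | s != t} =>
    left_coset (g (val s)) (H (val s))) a < m)%N.
  apply: contrapT => no_a; apply: not_cov => x; rewrite leqNgt; apply/negP => lt_x.
  by apply: no_a; exists x.
pose w' := #|[pred s | (s != t) && (a \in left_coset (g s) (H s))]|.
have {}lt_a : (w' < m)%N.
  apply: leq_ltn_trans lt_a; rewrite /w' /covering -(card_imset _ val_inj).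
  apply: subset_leq_card; apply/fintype.subsetP => s; rewrite !inE => /andP[s_t sa].
  apply/imsetP; exists (Sub s s_t); rewrite // inE; apply: set_mem.
have w_a : covering (fun s => left_coset (g s) (H s)) a =
           ((a \in left_coset (g t) (H t)) + w')%N.
  by rewrite /covering (cardD1 t) inE /w'; congr (_ + _)%N.
have ta : a \in left_coset (g t) (H t).
  have := A_mcover a; rewrite w_a; case: (_ \in _) => //.
  by rewrite add0n leqNgt lt_a.
have wa : covering (fun s => left_coset (g s) (H s)) a = m.
  by apply/eqP; rewrite eqn_leq A_mcover w_a ta add1n lt_a.
have sgL : is_subgroup (H t `&` K) by apply: subgroupI.
have subL x : K x -> (forall s, left_coset (g s) (H s) a -> H s x) ->
    (H t `&` K) x.
  by move=> Kx Hx; split=> //; apply: Hx; apply: set_mem.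
have [fiL leL] := mycielski_index_mcover H_subgroup A_mcover wa sgK abK sgL subL.
split=> //; rewrite (cardD1 t) inE; have -> /= : ~~ `[< K `<=` H t >] by apply/asboolPn.
rewrite leq_add2l; apply: leq_trans leL _.
apply: subset_leq_card; apply/fintype.subsetP => s; rewrite !inE => /andP[nsa ->].
by rewrite andbT; apply: contraNneq nsa => ->.
Qed.
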